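(* Let $H$ be an initial-closed graph with $\mu(H)=(\mu_1,\ldots,\mu_s,0,\ldots,0)\in\mathbb N^{n-1}$, where $1\le s\le n-3$. If $0<\mu_s=\cdots=\mu_1$, then $\beta_{2(n-1)-(\mu_1+s),\;2(n-1)-(\mu_1+s)+2}(H)$ is the unique extremal Betti number of $H$.
   Context: A graph $G$ on $\{1,\ldots,n\}$ (finite, simple) is closed (with respect to this labelling) if whenever $\{i,j\},\{i,k\}$ ($j\ne k$) are edges with either $i<j,i<k$ or $i>j,i>k$, then $\{j,k\}$ is an edge. A cut point of a connected graph is a vertex whose removal disconnects it. Let $G$ be a connected closed graph on $\{1,\ldots,n\}$, $n\ge2$, without cut point. Its initial-closed graph $H$ is the (connected, bipartite) graph with vertices $x_1,\ldots,x_{n-1}$ and (after renaming $y_j$ as $y_{j-1}$) $y_1,\ldots,y_{n-1}$, where $x_i$ is adjacent to $y_{j-1}$ iff $i<j$ and $\{i,j\}\in E(G)$. Put $\mu(H)=(\mu_1,\ldots,\mu_{n-1})$, $\mu_i:=n-i-\deg_H(x_i)$. Then $\mu_1\ge\cdots\ge\mu_{n-1}=0$ (with $\mu_{n-2}=0$ when $n\ge3$), $\mu_i\le n-2-i$ for $1\le i\le n-3$, and the edge ideal of $H$ is $I(H)=(x_iy_j\mid 1\le i\le n-1,\ i\le j\le n-1-\mu_i)$. For a graph $H$ and a fixed field $\Bbbk$, $\beta_{i,j}(H)$ denotes the graded Betti number $\beta_{i,j}(\Bbbk[V(H)]/I(H))$. A Betti number $\beta_{i,j}(H)\neq0$ is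 extremal if $\beta_{l,r}(H)=0$ for all $l\ge i$, $r\ge j+1$ with $r-l\ge j-i$. *)

(* Defs.v *)
From HB Require Import structures.
From mathcomp Require Import all_boot all_order all_algebra.
From mathcomp Require Import mpoly.

Set Implicit Arguments.
Unset Strict Implicit.
Unset Printing Implicit Defensive.

Import GRing.Theory.
Local Open Scope ring_scope.

Definition simple_graph (V : finType) (e : rel V) : Prop :=
  ssrbool.symmetric e /\ irreflexive e.

Definition connected_graph (V : finType) (e : rel V) : Prop :=
  forall u v : V, connect e u v.

Definition cut_point (V : finType) (e : rel V) (v : V) : Prop :=
  exists u w : V, [/\ u != v, w != v &
    ~~ connect [rel a b | [&& a != v, b != v & e a b]] u w].

Definition degree (V : finType) (e : rel V) (v : V) : nat := #|[set w | e v w]|.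

Definition closed_graph (n : nat) (e : rel 'I_n) : Prop :=
  forall i j k : 'I_n, j != k -> e i j -> e i k ->
    ((i < j) && (i < k) || (j < i) && (k < i))%N -> e j k.

(* Indices are shifted by one: the vertex [i : 'I_n] stands for i + 1, and
   [inl a], [inr b] with [a b : 'I_n.-1] stand for x_(a+1) and y_(b+1).  The
   latter comes from the vertex b + 2 of G, that is, from [b.+1 : 'I_n]. *)
Definition initial_closed (n : nat) (e : rel 'I_n) :
    rel ('I_n.-1 + 'I_n.-1)%type :=
  let xy (a b : 'I_n.-1) :=
    [exists i : 'I_n, exists j : 'I_n,
      [&& i == a :> nat, j == b.+1 :> nat, (i < j)%N & e i j]] in
  fun u v => match u, v with
             | inl a, inr b | inr b, inl a => xy a b
             | _, _ => false
             end.

(* The entry of index [a] is mu_(a+1); the subtractions never truncate, as x_i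
   has at most n - i neighbours. *)
Definition mu (n : nat) (e : rel 'I_n) : seq nat :=
  [seq (n - a.+1 - degree (initial_closed e) (inl a))%N | a : 'I_n.-1 <- enum 'I_n.-1].

Definition edge_ideal (K : fieldType) (V : finType) (e : rel V)
    (p : {mpoly K[#|V|]}) : Prop :=
  exists c : V -> V -> {mpoly K[#|V|]},
    p = \sum_u \sum_(v | e u v) c u v * ('X_(enum_rank u) * 'X_(enum_rank v)).

(* A minimal graded free resolution of S/I as a graded module over the
   standard graded ring S = K[X_0, ..., X_(r-1)].  The i-th free module is
   the direct sum of the S(-d), d ranging over the list [gens i] with
   multiplicity.  Elements of free modules are row vectors, on which the
   differentials act by right multiplication; [aug] lists lifts to S of the
   images in S/I of the generators in homological degree 0. *)
Record min_graded_resolution (K : fieldType) (r : nat)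
    (I : {mpoly K[r]} -> Prop) := MinGradedResolution {
  gens : nat -> seq nat;
  aug : 'cV[{mpoly K[r]}]_(size (gens 0%N));
  diff : forall i, 'M[{mpoly K[r]}]_(size (gens i.+1), size (gens i));
  aug_homog : forall (b : 'I_(size (gens 0%N))) m,
    m \in msupp (aug b ord0) -> mdeg m = nth 0%N (gens 0%N) b;
  diff_homog : forall i (a : 'I_(size (gens i.+1))) (b : 'I_(size (gens i))) m,
    m \in msupp (diff i a b) ->
    (mdeg m + nth 0 (gens i) b = nth 0 (gens i.+1) a)%N;
  aug_surj : forall p : {mpoly K[r]},
    exists v : 'rV_(size (gens 0%N)), I (p - (v *m aug) ord0 ord0);
  aug_exact : forall v : 'rV_(size (gens 0%N)),
    I ((v *m aug) ord0 ord0) <-> exists w, v = w *m diff 0%N;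
  diff_exact : forall i (v : 'rV_(size (gens i.+1))),
    v *m diff i = 0 <-> exists w, v = w *m diff i.+1;
  (* the image of each differential lies in (X_0, ..., X_(r-1)) F_i *)
  diff_minimal : forall i a b, (diff i a b)@_0%MM = 0
}.

(* The number of summands S(-j) of F_i.  Minimal graded free resolutions
   being unique up to isomorphism, this depends only on S/I. *)
Definition betti (K : fieldType) (r : nat) (I : {mpoly K[r]} -> Prop)
    (F : min_graded_resolution I) (i j : nat) : nat :=
  count_mem j (gens F i).

Definition extremal (beta : nat -> nat -> nat) (i j : nat) : Prop :=
  beta i j <> 0%N /\
  forall l r : nat, (i <= l)%N -> (j.+1 <= r)%N ->
    j%:Z - i%:Z <= r%:Z - l%:Z -> beta l r = 0%N.

(* Main.v *)
Require Import Defs.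
From HB Require Import structures.
From mathcomp Require Import all_boot all_order all_algebra.
From mathcomp Require Import mpoly.
From mathcomp Require Import zify.
From Stdlib Require Import IndefiniteDescription.

Set Implicit Arguments.
Unset Strict Implicit.
Unset Printing Implicit Defensive.
Import GRing.Theory.

(** Write N = n - 1, m = mu_1 and number rows and columns of H from 0.  The
    absence of cut points makes {i, i + 2} an edge of G, which gives m + s < N,
    and H consists of the pairs (x_a, y_b) with a <= b, except for the full
    s x m corner a < s, b >= N - m ([initial_closed_mu]).  So everything
    happens on a staircase with a rectangular notch.

    The Betti numbers are read off from a graded free resolution P of S/I that
    is built by iterated mapping cones and need not be minimal.  Adding one
    monomial f to an ideal I shifts the resolution of S/(I : f) by one
    homological step and by deg f, and places it next to that of S/I
    ([cone], [resolved_add]).  For squarefree monomial ideals the colon ideal is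
    again squarefree, and passing to I : f or I + (f) are Boolean operations on
    upward closed families of sets.  The pairs (x_a, y_b) are added in two
    batches, each in lexicographic order:
    - first all those with b < k := N - m.  Each colon ideal is generated by
      variables, so the result has projective dimension at most k and
      regularity at most 1 ([resolved_ferrers]);
    - then those with a >= s, b >= k.  The colon ideal is generated by the
      variables x_s..x_(a-1), y_a..y_(b-1) and by a smaller staircase that
      involves none of them, so its resolution has length b - s + min(a, k)
      and regularity at most 1 ([resolved_notched]).
    Hence P_l vanishes for l > p = k + (N - s), its generators have degree at
    most l + 2, and the very last pair contributes one in degree p + 2 to P_p.

    Comparing P with the given minimal resolution F finishes the proof.  The
    chain maps F -> P -> F and P -> F -> P lifting the identity of S/I are
    homotopic to the identity, and a homotopy is invisible modulo the
    variables at every generator where the differentials are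
    ([minimal_generator]).  All generators of F are of this kind, which bounds
    the position of its Betti numbers by those of P; the generator of P in
    position (p, p + 2) is of this kind too, because P_(p+1) = 0 and P_(p-1) has
    no generator of degree p + 2.  A nonzero Betti number in the extreme corner
    of the bounded region is the only extremal one
    ([unique_extremal_betti]). *)

Lemma dependent_choice (T : nat -> Type) (Q : forall l, T l -> Prop)
    (R : forall l, T l -> T l.+1 -> Prop) (x0 : T 0) :
  Q 0 x0 -> (forall l x, Q l x -> exists y, Q l.+1 y /\ R l x y) ->
  exists f : forall l, T l, f 0 = x0 /\ forall l, Q l (f l) /\ R l (f l) (f l.+1).
Proof.
move=> Qx0 step.
have next l (u : {x : T l | Q l x}) :
    {v : {y : T l.+1 | Q l.+1 y} | R l (sval u) (sval v)}.
  case: u => x Qx /=.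
  have [y [Qy Rxy]] := constructive_indefinite_description _ (step l x Qx).
  by exists (exist _ y Qy).
pose f := fix f l : {x : T l | Q l x} :=
  if l is l'.+1 then sval (next l' (f l')) else exist _ x0 Qx0.
exists (fun l => sval (f l)); split=> // l; split; first exact: (svalP (f l)).
exact: (svalP (next l (f l))).
Qed.

(** * Graded matrices over a polynomial ring *)

Section Homological.

Variables (K : fieldType) (r : nat).
Local Notation S := {mpoly K[r]}.
Local Open Scope ring_scope.
Implicit Types (I J : S -> Prop) (p q g : S).

Definition mrestrict (P : pred 'X_{1..r}) p : S :=
  \sum_(m <- msupp p | P m) p@_m *: 'X_[m].

Lemma mcoeff_mrestrict P p m :
  (mrestrict P p)@_m = if P m then p@_m else 0.
Proof.
rewrite /mrestrict raddf_sum /=.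
under eq_bigr do rewrite mcoeffZ mcoeffX.
case: (boolP (m \in msupp p)) => mp; last first.
  rewrite (memN_msupp_eq0 mp) if_same big_seq_cond big1 // => m' /andP[m'p _].
  by case: eqP m'p mp => [->->|]; rewrite ?mulr0.
rewrite -big_filter; case: ifP => Pm.
  rewrite (bigD1_seq m) ?filter_uniq ?msupp_uniq ?mem_filter ?Pm //=.
  rewrite eqxx mulr1 big1 ?addr0 // => m' /negPf ->.
  by rewrite mulr0.
rewrite big_seq big1 // => m'; rewrite mem_filter => /andP[Pm' _].
by case: eqP Pm' => [->|]; rewrite ?Pm ?mulr0.
Qed.

Lemma msupp_mrestrict P p m :
  (m \in msupp (mrestrict P p)) = P m && (m \in msupp p).
Proof.
by rewrite !mcoeff_msupp mcoeff_mrestrict; case: (P m); rewrite ?eqxx.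
Qed.

Lemma mrestrictD P p q : mrestrict P (p + q) = mrestrict P p + mrestrict P q.
Proof.
apply/mpolyP => m; rewrite mcoeffD !mcoeff_mrestrict mcoeffD.
by case: ifP; rewrite ?addr0.
Qed.

Lemma mrestrictB P p q : mrestrict P (p - q) = mrestrict P p - mrestrict P q.
Proof.
apply/mpolyP => m; rewrite mcoeffB !mcoeff_mrestrict mcoeffB.
by case: ifP; rewrite ?subr0.
Qed.

Lemma mrestrict_sum P (T : finType) (F : T -> S) :
  mrestrict P (\sum_i F i) = \sum_i mrestrict P (F i).
Proof.
apply: (big_morph _ (mrestrictD P)).
by apply/mpolyP => m; rewrite mcoeff_mrestrict mcoeff0 if_same.
Qed.

Lemma eq_mrestrict P P' p : P =1 P' -> mrestrict P p = mrestrict P' p.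
Proof. by move=> PP'; apply: eq_bigl. Qed.

Lemma mrestrict_id (P : pred 'X_{1..r}) p : {in msupp p, forall m, P m} -> mrestrict P p = p.
Proof.
move=> Pp; apply/mpolyP => m; rewrite mcoeff_mrestrict.
case: ifP => // /negbT PNm; rewrite memN_msupp_eq0 //.
by apply: contra PNm => /Pp.
Qed.

(** Selecting monomials commutes with multiplication by [q] as long as all
    monomials of [q] translate the selection in the same way; for selection by
    degree this says that [q] is homogeneous. *)
Lemma mrestrictM (P P' : pred 'X_{1..r}) p q :
  (forall m m', m' \in msupp q -> P (m + m')%MM = P' m) ->
  mrestrict P (p * q) = mrestrict P' p * q.
Proof.
move=> PP'; rewrite {1}[p]mpolyE mulr_suml.
rewrite (big_morph _ (mrestrictD P) (id1 := 0)); last first.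
  by apply/mpolyP => m; rewrite mcoeff_mrestrict mcoeff0 if_same.
rewrite /mrestrict mulr_suml [RHS]big_mkcond /=; apply: eq_bigr => m _.
apply/mpolyP => k; rewrite -/(mrestrict _ _) mcoeff_mrestrict.
have Esupp : k \in msupp ((p@_m *: 'X_[m]) * q) -> P k = P' m.
  move=> /msuppM_le /allpairsP [[m1 m2] /= [m1X m2q ->]].
  by have := msuppZ_le m1X; rewrite msuppX inE => /eqP ->; apply: PP'.
have [kin|kNin] := boolP (k \in msupp ((p@_m *: 'X_[m]) * q)).
  by rewrite Esupp //; case: (P' m); rewrite ?mcoeff0.
by case: (P' m); rewrite ?mcoeff0 (memN_msupp_eq0 kNin) if_same.
Qed.

(** A matrix is homogeneous of degree [e] if it is a degree [e] map from the
    graded free module with generators in degrees [al] to the one with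
    generators in degrees [be], acting on row vectors from the right. *)
Definition homog_mx e k l (al : 'I_k -> nat) (be : 'I_l -> nat)
    (A : 'M[S]_(k, l)) :=
  forall i j m, m \in msupp (A i j) -> (mdeg m + be j = al i + e)%N.

Definition hpart e k l (al : 'I_k -> nat) (be : 'I_l -> nat) (A : 'M[S]_(k, l)) :=
  \matrix_(i, j) mrestrict (fun m => (mdeg m + be j == al i + e)%N) (A i j).

Lemma hpart_homog e k l (al : 'I_k -> nat) (be : 'I_l -> nat) A :
  homog_mx e al be (hpart e al be A).
Proof. by move=> i j m; rewrite mxE msupp_mrestrict => /andP[/eqP]. Qed.

Lemma hpart_id e k l (al : 'I_k -> nat) (be : 'I_l -> nat) A :
  homog_mx e al be A -> hpart e al be A = A.
Proof.
move=> hA; apply/matrixP => i j; rewrite mxE mrestrict_id // => m mA.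
exact/eqP/hA.
Qed.

(** Taking homogeneous parts commutes with homogeneous maps, so any lift through
    such a map can be replaced by a homogeneous one, as in [homog_lift]. *)
Lemma hpartM e k l n (al : 'I_k -> nat) (be : 'I_l -> nat) (ga : 'I_n -> nat)
    (A : 'M[S]_(k, l)) (B : 'M[S]_(l, n)) :
  homog_mx 0 be ga B -> hpart e al ga (A *m B) = hpart e al be A *m B.
Proof.
move=> hB; apply/matrixP => i j; rewrite !mxE mrestrict_sum.
apply: eq_bigr => a _; rewrite !mxE; apply: mrestrictM => m m' /hB E /=.
by rewrite mdegD -addnA E addn0.
Qed.

Lemma homog_mxM e e' k l n (al : 'I_k -> nat) (be : 'I_l -> nat) (ga : 'I_n -> nat)
    (A : 'M[S]_(k, l)) (B : 'M[S]_(l, n)) :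
  homog_mx e al be A -> homog_mx e' be ga B -> homog_mx (e + e') al ga (A *m B).
Proof.
move=> hA hB i j m; rewrite mxE => /msupp_sum_le /flattenP [s /mapP [a _ ->]].
move=> /msuppM_le /allpairsP [[m1 m2] /= [m1A m2B ->]].
by rewrite mdegD; have := hA _ _ _ m1A; have := hB _ _ _ m2B; lia.
Qed.

Lemma row_lift k l n (A : 'M[S]_(k, n)) (B : 'M[S]_(l, n)) :
  (forall v : 'rV_k, exists w : 'rV_l, v *m A = w *m B) -> exists W, A = W *m B.
Proof.
move=> lft; have /fin_all_exists [W WE] : forall i, exists w : 'rV_l, row i A = w *m B.
  by move=> i; have [w] := lft (delta_mx 0 i); rewrite -rowE => ?; exists w.
exists (\matrix_i W i); apply/row_matrixP => i.
by rewrite row_mul rowK WE.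
Qed.

Lemma homog_lift e k l n (al : 'I_k -> nat) (be : 'I_l -> nat) (ga : 'I_n -> nat)
    (A : 'M[S]_(k, n)) (B : 'M[S]_(l, n)) :
  homog_mx e al ga A -> homog_mx 0 be ga B ->
  (forall v : 'rV_k, exists w : 'rV_l, v *m A = w *m B) ->
  exists W, homog_mx e al be W /\ A = W *m B.
Proof.
move=> hA hB /row_lift [W WE]; exists (hpart e al be W).
by split; [exact: hpart_homog | rewrite -(hpartM _ _ _ hB) -WE hpart_id].
Qed.

(** * Graded free resolutions and the comparison theorem *)

Record graded_ideal I : Prop := GradedIdeal {
  idealD : forall p q, I p -> I q -> I (p + q);
  idealM : forall p q, I q -> I (p * q);
  ideal_restrict : forall d p, I p -> I (mrestrict (fun m => mdeg m == d) p)
}.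

Lemma idealN I p : graded_ideal I -> I p -> I (- p).
Proof. by move=> gI /(idealM gI (-1)); rewrite mulN1r. Qed.

Lemma idealB I p q : graded_ideal I -> I p -> I q -> I (p - q).
Proof. by move=> gI Ip /(idealN gI); exact: idealD gI _ _ Ip. Qed.

Lemma ideal0 I p : graded_ideal I -> I p -> I 0.
Proof. by move=> gI /(idealM gI 0); rewrite mul0r. Qed.

(** A graded free resolution of S/I: the l-th module has [rk l] generators, in
    degrees [dg], and [eps] gives lifts to S of the images in S/I of the
    generators of the first one.  Unlike in [min_graded_resolution], constants
    may occur in the differentials. *)
Record gres I := Gres {
  rk : nat -> nat;
  dg : forall l, 'I_(rk l) -> nat;
  eps : 'cV[S]_(rk 0);
  dif : forall l, 'M[S]_(rk l.+1, rk l);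
  eps_homog : homog_mx 0 (@dg 0) (fun=> 0%N) eps;
  dif_homog : forall l, homog_mx 0 (@dg l.+1) (@dg l) (dif l);
  eps_surj : forall p, exists v : 'rV_(rk 0), I (p - (v *m eps) 0 0);
  eps_exact : forall v : 'rV_(rk 0), I ((v *m eps) 0 0) <-> exists w, v = w *m dif 0;
  dif_exact : forall l (v : 'rV_(rk l.+1)),
    v *m dif l = 0 <-> exists w, v = w *m dif l.+1
}.
Arguments dg {I} g {l} i.

Lemma mul_dif_eps I (P : gres I) (v : 'rV_(rk P 1)) :
  I ((v *m dif P 0 *m eps P) 0 0).
Proof. by apply/eps_exact; exists v. Qed.

Lemma mul_dif_dif I (P : gres I) l : dif P l.+1 *m dif P l = 0.
Proof.
apply/row_matrixP => i; rewrite row_mul row0.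
by apply/dif_exact; exists (delta_mx 0 i); rewrite -rowE.
Qed.

Lemma ideal_sum I (T : finType) (F : T -> S) : graded_ideal I -> I 0 ->
  (forall i, I (F i)) -> I (\sum_i F i).
Proof. by move=> gI I0 IF; elim/big_ind: _ => //; exact: idealD gI. Qed.

(** Chain maps of degree [e] lifting the multiplication by [g] from S/J to
    S/I. *)
Record chain_map I J (P : gres J) (Q : gres I) (e : nat) (g : S)
    (phi : forall l, 'M[S]_(rk P l, rk Q l)) : Prop := ChainMap {
  chain_homog : forall l, homog_mx e (@dg _ P l) (@dg _ Q l) (phi l);
  chain_eps : forall v : 'rV_(rk P 0), I ((v *m phi 0 *m eps Q) 0 0 - (v *m eps P) 0 0 * g);
  chain_dif : forall l, phi l.+1 *m dif Q l = dif P l *m phi l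
}.

Arguments chain_map {I J} P Q e g phi.

Lemma graded_ideal0 I (P : gres I) : graded_ideal I -> I 0.
Proof. by move=> gI; have [v /(ideal0 gI)] := eps_surj P 0. Qed.

(** The usual lifting along an exact complex of free modules.  The degrees are
    repaired at each step, since a lift of a homogeneous map through homogeneous
    differentials has a homogeneous part that is still a lift. *)
Lemma chain_map_exists I J (P : gres J) (Q : gres I) e g :
  graded_ideal I -> graded_ideal J -> {in msupp g, forall m, mdeg m = e} ->
  (forall p, J p -> I (p * g)) -> exists phi, chain_map P Q e g phi.
Proof.
move=> gI gJ hg JI; have I0 := graded_ideal0 Q gI.
have hgP : homog_mx e (@dg _ P 0) (fun=> 0%N) (map_mx ( *%R^~ g) (eps P)).
  move=> i j m; rewrite mxE => /msuppM_le /allpairsP [[m1 m2] /= [/eps_homog + /hg <- ->]].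
  by rewrite mdegD; lia.
have /fin_all_exists [f fE] i : exists w : 'rV_(rk Q 0),
    I ((w *m eps Q) 0 0 - eps P i 0 * g).
  have [w Iw] := eps_surj Q (eps P i 0 * g); exists w.
  by rewrite -opprB; apply: idealN.
pose phi0 := hpart e (@dg _ P 0) (@dg _ Q 0) (\matrix_i f i).
have phi0E i : I ((phi0 *m eps Q) i 0 - eps P i 0 * g).
  have := ideal_restrict gI (dg P i + e) (fE i).
  rewrite mrestrictB; set q1 := mrestrict _ _; set q2 := mrestrict _ _.
  suff [-> ->] : q1 = (phi0 *m eps Q) i 0 /\ q2 = eps P i 0 * g by [].
  split; last by apply: mrestrict_id => m; have := hgP i 0 m; rewrite mxE addn0 => + mS => /(_ mS) ->.
  rewrite -(hpartM _ _ _ (@eps_homog _ Q)) mxE /q1 -[f i]rowK -row_mul mxE.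
  by apply: eq_mrestrict => m; rewrite addn0.
have phi0eps (v : 'rV_(rk P 0)) : I ((v *m phi0 *m eps Q) 0 0 - (v *m eps P) 0 0 * g).
  rewrite -mulmxA !mxE mulr_suml -sumrB; apply: ideal_sum => // i.
  by rewrite -mulrA -mulrBr; apply: idealM.
pose good l (x : 'M[S]_(rk P l, rk Q l)) := homog_mx e (@dg _ P l) (@dg _ Q l) x /\
  forall v : 'rV_(rk P l.+1), exists w, v *m (dif P l *m x) = w *m dif Q l.
have [||phi [phi0D phiP]] := @dependent_choice _ good
  (fun l x y => y *m dif Q l = dif P l *m x) phi0.
- split; first exact: hpart_homog.
  move=> v; apply/eps_exact; rewrite mulmxA.
  rewrite -[X in I X](subrK ((v *m dif P 0 *m eps P) 0 0 * g)).
  by apply: (idealD gI (phi0eps _)); apply: JI; apply: mul_dif_eps.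
- move=> l x [hx lft].
  have [y [hy yE]] := homog_lift (homog_mxM (@dif_homog _ P l) hx) (@dif_homog _ Q l) lft.
  exists y; split; last by rewrite -yE.
  split=> // v; apply/dif_exact.
  by rewrite -!mulmxA -yE (mulmxA (dif P l.+1)) mul_dif_dif mul0mx mulmx0.
- exists phi; split=> [l|v|l]; first by case: (phiP l) => [[]].
  + by rewrite phi0D.
  + by case: (phiP l).
Qed.

(** The difference of two self-maps lifting the same endomorphism of S/I lifts
    zero, and exactness lets a contraction be chosen step by step. *)
Lemma null_homotopy I (P : gres I) (chi : forall l, 'M[S]_(rk P l)) :
  graded_ideal I ->
  (forall v : 'rV_(rk P 0), I ((v *m chi 0 *m eps P) 0 0)) ->
  (forall l, chi l.+1 *m dif P l = dif P l *m chi l) ->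
  exists h : forall l, 'M[S]_(rk P l, rk P l.+1),
    chi 0 = h 0 *m dif P 0 /\
    forall l, chi l.+1 = dif P l *m h l + h l.+1 *m dif P l.+1.
Proof.
move=> gI chi0 chiC.
have [h0 h0E] : exists h0, chi 0 = h0 *m dif P 0.
  by apply: row_lift => v; apply/eps_exact.
have [||h [h0D hP]] := @dependent_choice _
  (fun l (h : 'M[S]_(rk P l, rk P l.+1)) => forall v : 'rV_(rk P l.+1),
     exists w, v *m (chi l.+1 - dif P l *m h) = w *m dif P l.+1)
  (fun l h h' => chi l.+1 - dif P l *m h = h' *m dif P l.+1) h0.
- move=> v; apply/dif_exact.
  by rewrite -mulmxA mulmxBl chiC h0E -!mulmxA subrr mulmx0.
- move=> l h /row_lift [h' h'E]; exists h'; split=> // v; apply/dif_exact.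
  rewrite -mulmxA mulmxBl chiC -[_ *m h' *m _]mulmxA -h'E -mulmxBr subKr.
  by rewrite [_ *m (_ *m h)]mulmxA mul_dif_dif mul0mx mulmx0.
- exists h; split=> [|l]; first by rewrite h0D.
  by have [_ <-] := hP l; rewrite addrC subrK.
Qed.

Lemma chain_map_comp I (P Q : gres I) phi psi : graded_ideal I ->
  chain_map P Q 0 1 phi -> chain_map Q P 0 1 psi ->
  chain_map P P 0 1 (fun l => phi l *m psi l).
Proof.
move=> gI [h1 e1 d1] [h2 e2 d2]; split=> [l|v|l].
- exact: (homog_mxM (h1 l) (h2 l)).
- have := idealD gI (e2 (v *m phi 0)) (e1 v).
  by rewrite !mulr1 addrA subrK !mulmxA.
- by rewrite -mulmxA d2 mulmxA d1 mulmxA.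
Qed.

Lemma const_mulmx k l n (A : 'M[S]_(k, l)) (B : 'M[S]_(l, n)) i j :
  ((A *m B) i j)@_0%MM = \sum_a (A i a)@_0%MM * (B a j)@_0%MM.
Proof. by rewrite mxE raddf_sum; apply: eq_bigr => a _; rewrite /= rmorphM. Qed.

(** The differentials have no constant term in the row or the column of [b], so
    no cancellation against a neighbouring module can involve [b]. *)
Definition minimal_at I (P : gres I) l (b : 'I_(rk P l)) : Prop :=
  (forall c, (dif P l c b)@_0%MM = 0) /\
  (if l is l'.+1 return 'I_(rk P l) -> Prop
   then fun b => forall c, (dif P l' b c)@_0%MM = 0 else fun=> True) b.

(** If phi : P -> Q and psi : Q -> P lift the identity, then 1 - psi phi is a
    homotopy [d h + h d], whose diagonal entry at [b] has no constant term.
    Hence some product of constants phi_bc psi_cb is nonzero; as phi has degree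
    0, the generators b and c have the same degree. *)
Lemma minimal_generator I (P Q : gres I) l (b : 'I_(rk P l)) :
  graded_ideal I -> minimal_at b -> exists c : 'I_(rk Q l), dg Q c = dg P b.
Proof.
move=> gI bmin; have h1 : {in msupp (1 : S), forall m, mdeg m = 0%N}.
  by move=> m; rewrite msupp1 inE => /eqP->; rewrite mdeg0.
have II p : I p -> I (p * 1) by rewrite mulr1.
have [phi phiP] := chain_map_exists P Q gI gI h1 II.
have [psi psiP] := chain_map_exists Q P gI gI h1 II.
have [cH ce cd] := chain_map_comp gI phiP psiP.
have [||h [h0E hE]] := @null_homotopy I P (fun l => 1%:M - phi l *m psi l) gI.
- move=> v; rewrite mulmxBr mulmx1 mulmxBl [X in I X]mxE [X in _ + X]mxE -opprB.
  by apply: idealN => //; have := ce v; rewrite mulr1.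
- by move=> k; rewrite mulmxBl mulmxBr mul1mx mulmx1 cd.
have E : ((phi l *m psi l) b b)@_0%MM = 1.
  suff : ((1%:M - phi l *m psi l) b b)@_0%MM = 0.
    rewrite mxE [in X in _ + X]mxE mxE eqxx mcoeffB mcoeff1 eqxx => /eqP.
    by rewrite subr_eq0 => /eqP <-.
  case: l b bmin => [|l] b [bcol brow].
    by rewrite h0E const_mulmx big1 // => a _; rewrite bcol mulr0.
  rewrite hE [X in X@_ _]mxE mcoeffD !const_mulmx !big1 ?addr0 // => a _.
    by rewrite bcol mulr0.
  by rewrite brow mul0r.
have /existsP [c nz] : [exists c, (phi l b c)@_0%MM != 0].
  apply: contra_eqT E => /existsPn z; rewrite const_mulmx big1 ?(eq_sym 0) ?oner_eq0 //.
  by move=> c _; have := z c; rewrite negbK => /eqP ->; rewrite mul0r.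
exists c; have := chain_homog phiP; move=> /(_ l b c 0%MM).
by rewrite mcoeff_msupp mdeg0 addn0 => /(_ nz).
Qed.

(** * Adding one generator to an ideal: the mapping cone *)

Section Cone.

Variables (I J I' : S -> Prop) (e : nat) (g : S).
Variables (Q : gres I) (R : gres J) (phi : forall l, 'M[S]_(rk R l, rk Q l)).
Hypotheses (gI : graded_ideal I) (phiP : chain_map R Q e g phi).
Hypothesis colonJ : forall p, I (p * g) -> J p.
Hypothesis I'E : forall p, I' p <-> exists c, I (p - c * g).

Definition cone_rk l := if l is l'.+1 then (rk Q l + rk R l')%N else rk Q 0.

Definition cone_dg l : 'I_(cone_rk l) -> nat :=
  match l with
  | 0 => @dg _ Q 0
  | l'.+1 => fun i => match split i with
                      | inl j => dg Q j
                      | inr j => (dg R j + e)%N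
                      end
  end.

Definition cone_dif l : 'M[S]_(cone_rk l.+1, cone_rk l) :=
  match l with
  | 0 => col_mx (dif Q 0) (phi 0)
  | l'.+1 => block_mx (dif Q l'.+1) 0 (phi l'.+1) (- dif R l')
  end.

Lemma homog_mx_col k1 k2 l e' (al : 'I_(k1 + k2) -> nat) (be : 'I_l -> nat)
    (A : 'M[S]_(k1, l)) (B : 'M[S]_(k2, l)) :
  homog_mx e' (fun i => al (lshift k2 i)) be A ->
  homog_mx e' (fun i => al (rshift k1 i)) be B ->
  homog_mx e' al be (col_mx A B).
Proof.
move=> hA hB i j m; rewrite -[i]splitK; case: (split i) => a /=.
  by rewrite col_mxEu => /hA.
by rewrite col_mxEd => /hB.
Qed.

Lemma homog_mx_row k l1 l2 e' (al : 'I_k -> nat) (be : 'I_(l1 + l2) -> nat)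
    (A : 'M[S]_(k, l1)) (B : 'M[S]_(k, l2)) :
  homog_mx e' al (fun i => be (lshift l2 i)) A ->
  homog_mx e' al (fun i => be (rshift l1 i)) B ->
  homog_mx e' al be (row_mx A B).
Proof.
move=> hA hB i j m; rewrite -[j]splitK; case: (split j) => a /=.
  by rewrite row_mxEl => /hA.
by rewrite row_mxEr => /hB.
Qed.

Lemma homog_mx0 k l e' (al : 'I_k -> nat) (be : 'I_l -> nat) :
  homog_mx e' al be 0.
Proof. by move=> i j m; rewrite mxE msupp0. Qed.

Lemma cone_dif_homog l : homog_mx 0 (@cone_dg l.+1) (@cone_dg l) (cone_dif l).
Proof.
have splitl k1 k2 (i : 'I_k1) : split (lshift k2 i) = inl i.
  by rewrite -[lshift _ _]/(unsplit (inl i)) unsplitK.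
have splitr k1 k2 (i : 'I_k2) : split (rshift k1 i) = inr i.
  by rewrite -[rshift _ _]/(unsplit (inr i)) unsplitK.
have hphi := chain_homog phiP.
case: l => [|l]; apply: homog_mx_col => [|i j m]; rewrite /cone_dg ?splitl ?splitr.
- by move=> i j m; rewrite splitl; apply: dif_homog.
- by move=> /hphi ->; rewrite addn0.
- apply: homog_mx_row; last exact: homog_mx0.
  by move=> i j m; rewrite !splitl; apply: dif_homog.
- move: i j m; apply: homog_mx_row => i j m; rewrite ?splitl ?splitr.
    by move=> /hphi ->; rewrite addn0.
  by rewrite mxE (perm_mem (msuppN _)) => /dif_homog; lia.
Qed.

Lemma mul_cone_dif0 (q : 'rV_(rk Q 1)) (b : 'rV_(rk R 0)) :
  row_mx q b *m cone_dif 0 = q *m dif Q 0 + b *m phi 0.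
Proof. exact: mul_row_col. Qed.

Lemma mul_cone_difS l (q : 'rV_(rk Q l.+2)) (b : 'rV_(rk R l.+1)) :
  row_mx q b *m cone_dif l.+1 =
  row_mx (q *m dif Q l.+1 + b *m phi l.+1) (- (b *m dif R l)).
Proof. by rewrite mul_row_block mulmx0 add0r mulmxN. Qed.

Lemma cone_surj p : exists v : 'rV_(cone_rk 0), I' (p - (v *m eps Q) 0 0).
Proof.
have [v Iv] := eps_surj Q p; exists v; apply/I'E; exists 0.
by rewrite mul0r subr0.
Qed.

Lemma chain_eps_colon (b : 'rV_(rk R 0)) c : J (c - (b *m eps R) 0 0) ->
  (forall p, J p -> I (p * g)) -> I ((b *m phi 0 *m eps Q) 0 0 - c * g).
Proof.
move=> Jb JI; have := idealB gI (chain_eps phiP b) (JI _ Jb).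
by rewrite mulrBl opprB addrA subrK.
Qed.

Hypothesis JI : forall p, J p -> I (p * g).

(** An element of I + (g) is congruent to c g modulo I; expressing c through the
    augmentation of R corrects it to an element of I. *)
Lemma cone_eps_exact (v : 'rV_(cone_rk 0)) :
  I' ((v *m eps Q) 0 0) <-> exists w, v = w *m cone_dif 0.
Proof.
split=> [/I'E [c Ic]|[w ->]].
  have [b Jb] := eps_surj R c.
  have : I (((v - b *m phi 0) *m eps Q) 0 0).
    have := idealB gI Ic (chain_eps_colon Jb JI).
    by rewrite mulmxBl [X in _ -> I X]mxE [in X in _ -> I (_ + X)]mxE opprB addrA subrK.
  move=> /eps_exact [q qE]; exists (row_mx q b).
  by rewrite mul_cone_dif0 -qE subrK.
rewrite -[w]hsubmxK mul_cone_dif0; set q := lsubmx w; set b := rsubmx w.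
apply/I'E; exists ((b *m eps R) 0 0) => /=.
rewrite mulmxDl [X in I (X - _)]mxE -addrA.
by have := idealD gI (mul_dif_eps q) (chain_eps phiP b).
Qed.

(** In a cycle (q, b) of the cone, b is a cycle of R; for the lowest differential
    this means that [b eps] lies in I : g, as [b eps g] lies in I.  So b is a
    boundary b' d, and q + b' phi is a cycle of Q. *)
Lemma cone_dif_exact l (v : 'rV_(cone_rk l.+1)) :
  v *m cone_dif l = 0 <-> exists w, v = w *m cone_dif l.+1.
Proof.
have phiC l' := chain_dif phiP l'.
suff lft (q : 'rV_(rk Q l.+1)) (b : 'rV_(rk R l)) :
    (exists b', b = b' *m dif R l) -> (q *m dif Q l + b *m phi l = 0) ->
    exists w, row_mx q b = w *m cone_dif l.+1.
  rewrite -[v]hsubmxK; split.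
    case: l v lft => [|l] v lft.
      rewrite mul_cone_dif0 => v0; apply: lft => //.
      apply/eps_exact/colonJ; set b := rsubmx v.
      have /(idealB gI (mul_dif_eps (- lsubmx v))) := chain_eps phiP b.
      have -> : - lsubmx v *m dif Q 0 = b *m phi 0.
        by rewrite mulNmx; apply/eqP; rewrite eq_sym -addr_eq0 addrC v0.
      by rewrite opprB addrC subrK.
    rewrite mul_cone_difS -[0]row_mx0 => /eq_row_mx [v0 /eqP].
    rewrite oppr_eq0 => /eqP b0; apply: lft => //; exact/dif_exact.
  move=> [w ->]; rewrite -[w]hsubmxK mul_cone_difS.
  have z (q : 'rV_(rk Q l.+2)) (b : 'rV_(rk R l.+1)) :
     (q *m dif Q l.+1 + b *m phi l.+1) *m dif Q l + - (b *m dif R l) *m phi l = 0.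
    by rewrite mulmxDl -!mulmxA mul_dif_dif mulmx0 add0r phiC mulNmx -mulmxA subrr.
  case: l v lft w z => [|l] v lft w z; first by rewrite mul_cone_dif0 z.
  by rewrite mul_cone_difS z mulNmx -mulmxA mul_dif_dif mulmx0 !oppr0 row_mx0.
move=> [b' ->] qb0.
have /dif_exact [q' q'E] : (q + b' *m phi l.+1) *m dif Q l = 0.
  by rewrite mulmxDl -[b' *m _ *m _]mulmxA phiC mulmxA.
exists (row_mx q' (- b')); rewrite mul_cone_difS !mulNmx opprK -q'E.
by rewrite addrK.
Qed.

Definition cone : gres I' :=
  @Gres I' cone_rk cone_dg (eps Q) cone_dif (@eps_homog _ Q) cone_dif_homog
    cone_surj cone_eps_exact cone_dif_exact.

End Cone.

(** The zero ideal is resolved by S alone, a module of rank [l == 0] at each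
    step l. *)
Lemma free_gres_dif_exact l (v : 'rV[S]_(l.+1 == 0%N)) :
  v *m (0 : 'M_(_, l == 0%N)) = 0 <-> exists w, v = w *m (0 : 'M_(l.+2 == 0%N, _)).
Proof. by split=> _; [exists 0|]; rewrite [v]thinmx0 mul0mx. Qed.

End Homological.

Arguments dg {K r I} g {l} i.

(** * Squarefree monomial ideals *)

Section Squarefree.

Variables (K : fieldType) (r : nat).
Local Notation S := {mpoly K[r]}.
Local Open Scope ring_scope.
Implicit Types (U : pred {set 'I_r}) (f A B : {set 'I_r}).

Definition mnm_supp (m : 'X_{1..r}) : {set 'I_r} := [set i | m i != 0%N].

(** Squarefree monomial ideals correspond to upward closed families of sets of
    variables: a monomial belongs to the ideal if its support is in the family.
    The family is the complement of the Stanley-Reisner complex. *)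
Definition upclosed U := forall A B, A \subset B -> U A -> U B.

Definition sqfree_ideal U (p : S) : Prop :=
  forall m, m \in msupp p -> U (mnm_supp m).

Definition mnm_set f : 'X_{1..r} := [multinom (i \in f : nat) | i < r].

Lemma mdeg_mnm_set f : mdeg (mnm_set f) = #|f|.
Proof.
rewrite mdegE -sum1_card [RHS]big_mkcond; apply: eq_bigr => i _.
by rewrite mnmE; case: (i \in f).
Qed.

Lemma mnm_suppD m m' : mnm_supp (m + m')%MM = mnm_supp m :|: mnm_supp m'.
Proof. by apply/setP => i; rewrite !inE mnmDE addn_eq0 negb_and. Qed.

Lemma mnm_supp_set f : mnm_supp (mnm_set f) = f.
Proof. by apply/setP => i; rewrite inE mnmE; case: (i \in f). Qed.

Lemma sqfree_graded_ideal U : upclosed U -> graded_ideal (sqfree_ideal U).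
Proof.
move=> up; split=> [p q Ip Iq m|p q Iq m|d p Ip m].
- by move=> /msuppD_le; rewrite mem_cat => /orP [/Ip|/Iq].
- move=> /msuppM_le /allpairsP [[m1 m2] /= [_ /Iq U2 ->]].
  by apply: up U2; rewrite mnm_suppD subsetUr.
- by rewrite msupp_mrestrict => /andP [_ /Ip].
Qed.

Lemma sqfree_colon U f (p : S) :
  sqfree_ideal U (p * 'X_[mnm_set f]) <-> sqfree_ideal (fun A => U (A :|: f)) p.
Proof.
split=> Ip m mp.
  rewrite -(mnm_supp_set f) -mnm_suppD; apply: Ip.
  by rewrite (perm_mem (msuppMX _ _)) addmC map_f.
move: mp; rewrite (perm_mem (msuppMX _ _)) => /mapP [m' /Ip Um' ->].
by rewrite addmC mnm_suppD mnm_supp_set.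
Qed.

(** Collecting the monomials of [p] divisible by the generator writes [p] as a
    multiple of it plus a remainder supported on the old family. *)
Lemma sqfree_add U f (p : S) : upclosed U ->
  sqfree_ideal (fun A => U A || (f \subset A)) p <->
  exists c, sqfree_ideal U (p - c * 'X_[mnm_set f]).
Proof.
move=> up; split=> [Ip|[c Ic] m].
  pose P m := f \subset mnm_supp m.
  exists (\sum_(m <- msupp p | P m) p@_m *: 'X_[m - mnm_set f]).
  rewrite mulr_suml (eq_bigr (fun m => p@_m *: 'X_[m])) => [|m /subsetP Pm].
    rewrite -/(mrestrict P p) => m.
    rewrite mcoeff_msupp mcoeffB mcoeff_mrestrict.
    case: ifP => [_|NPm]; first by rewrite subrr eqxx.
    by rewrite subr0 -mcoeff_msupp => /Ip; rewrite -/(P m) NPm orbF.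
  rewrite -scalerAl -mpolyXD submK //; apply/mnm_lepP => i; rewrite mnmE.
  by case: (boolP (i \in f)) => // /Pm; rewrite inE lt0n.
rewrite -{1}[p](subrK (c * 'X_[mnm_set f])) => /msuppD_le.
rewrite mem_cat => /orP [/Ic -> //|].
rewrite (perm_mem (msuppMX _ _)) => /mapP [m' _ ->].
by rewrite mnm_suppD mnm_supp_set subsetUl orbT.
Qed.

(** Bounds p on the projective dimension and q on the regularity, with a flag
    recording that the corner (p, p + q) is occupied.  Since the resolution need
    not be minimal, these data pass through mapping cones without any control of
    cancellation. *)
Definition resolved U (p q : nat) (t : bool) : Prop :=
  exists P : gres (sqfree_ideal U),
    [/\ forall l, (p < l)%N -> rk P l = 0%N,
        forall l (b : 'I_(rk P l)), (dg P b <= l + q)%N &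
        t -> exists b : 'I_(rk P p), dg P b = (p + q)%N].

Definition gres_ext (I I' : S -> Prop) (II' : forall p, I p <-> I' p) (P : gres I) : gres I'.
Proof.
apply: (@Gres _ _ I' (rk P) (@dg _ _ _ P) (eps P) (dif P)).
- exact: eps_homog.
- exact: dif_homog.
- by move=> p; have [v Iv] := eps_surj P p; exists v; apply/II'.
- by move=> v; rewrite -II'; exact: eps_exact.
- exact: dif_exact.
Defined.

Lemma eq_resolved U U' p q t : U =1 U' -> resolved U p q t -> resolved U' p q t.
Proof.
move=> UU' [P [Ppd Preg Ptop]].
have II' x : sqfree_ideal U x <-> sqfree_ideal U' x.
  by split=> Ix m /Ix; rewrite UU'.
by exists (gres_ext II' P).
Qed.

Lemma resolvedW U p q t p' q' : (p <= p')%N -> (q <= q')%N ->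
  resolved U p q t -> resolved U p' q' (t && (p == p') && (q == q')).
Proof.
move=> pp' qq' [P [Ppd Preg Ptop]]; exists P; split=> [l pl|l b|].
- by apply: Ppd; apply: leq_ltn_trans pl.
- by apply: leq_trans (Preg l b) _; rewrite leq_add2l.
- by move=> /andP [/andP[/Ptop + /eqP<-] /eqP<-].
Qed.

Lemma resolved0 : resolved xpred0 0 0 true.
Proof.
have I0 (p : S) : sqfree_ideal xpred0 p <-> p = 0.
  split=> [Ip|->]; last by move=> m; rewrite msupp0.
  by apply/mpolyP => m; rewrite mcoeff0 memN_msupp_eq0 //; apply/negP => /Ip.
have surj (p : S) : exists v : 'rV_1, sqfree_ideal xpred0 (p - (v *m 1%:M) 0 0).
  by exists (p%:M); apply/I0; rewrite mulmx1 mxE eqxx subrr.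
have exact0 (v : 'rV_1) : sqfree_ideal xpred0 ((v *m 1%:M) 0 0) <->
    exists w : 'rV_0, v = w *m (0 : 'M[S]_(0, 1)).
  rewrite mulmx1 I0; split=> [v0|[w ->]]; last by rewrite mulmx0 mxE.
  by exists 0; rewrite mulmx0; apply/rowP => i; rewrite (ord1 i) mxE.
have eps_h : homog_mx 0 (fun _ : 'I_1 => 0%N) (fun _ : 'I_1 => 0%N) (1%:M : 'M[S]_1).
  by move=> i j m; rewrite (ord1 i) (ord1 j) mxE msupp1 inE => /eqP ->; rewrite mdeg0.
have dif_h l : homog_mx 0 (fun _ : 'I_(l.+1 == 0%N) => 0%N) (fun _ : 'I_(l == 0%N) => 0%N) (0 : 'M[S]_(_, _)).
  by move=> i j m; rewrite mxE msupp0.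
exists (@Gres _ _ (sqfree_ideal xpred0) (fun l => l == 0%N) (fun _ _ => 0%N)
          (1%:M : 'M_1) (fun l => 0) eps_h dif_h surj exact0
          (@free_gres_dif_exact K r)).
by split=> [[]|//|_] //; exists ord0.
Qed.

(** The generators that the cone takes from the resolution of the colon ideal
    go up by one in homological degree and gain the degree of the new generator. *)
Lemma resolved_add U f p q t p' q' t' : upclosed U ->
  resolved U p q t -> resolved (fun A => U (A :|: f)) p' q' t' ->
  (p' < p)%N -> (q' + #|f| <= q.+1)%N ->
  resolved (fun A => U A || (f \subset A)) p q
    (t || [&& t', p'.+1 == p & (q' + #|f| == q.+1)%N]).
Proof.
move=> up [P [Ppd Preg Ptop]] [R [Rpd Rreg Rtop]] p'p q'q.
have gI := sqfree_graded_ideal up.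
have upJ : upclosed (fun A => U (A :|: f)).
  by move=> A B AB; apply/up/setSU.
have colon := sqfree_colon U f.
have hg : {in msupp ('X_[mnm_set f] : S), forall m, mdeg m = #|f|}.
  by move=> m; rewrite msuppX inE => /eqP ->; rewrite mdeg_mnm_set.
have [phi phiP] := chain_map_exists R P gI (sqfree_graded_ideal upJ) hg
   (fun x => proj2 (colon x)).
have I'E x := sqfree_add f x up.
exists (cone gI phiP (fun x => proj1 (colon x)) I'E (fun x => proj2 (colon x))).
split.
- case=> [|l] // pl; rewrite /= Ppd // Rpd //.
  exact: leq_trans p'p _.
- case=> [|l] /= b; first exact: Preg.
  case: (split b) => j; first exact: Preg.
  have := Rreg _ j; rewrite -(leq_add2r #|f|) => /leq_trans; apply.
  by rewrite addSn -addnS -addnA leq_add2l.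
- case/orP => [/Ptop|/and3P [/Rtop [b bE] /eqP pE /eqP qE]].
    case: p {p'p Ppd Ptop} => [|p] [b bE]; first by exists b.
    exists (lshift (rk R p) b) => /=.
    by rewrite -[lshift _ _]/(unsplit (inl b)) unsplitK.
  case: p / pE {Ppd Ptop p'p}; exists (rshift (rk P p'.+1) b) => /=.
  by rewrite -[rshift _ _]/(unsplit (inr b)) unsplitK bE -addnA qE addnS addSn.
Qed.

Lemma resolved_flag U p q (t t' : bool) : (t' -> t) -> resolved U p q t -> resolved U p q t'.
Proof. by move=> tt' [P [? ? Ptop]]; exists P; split=> // /tt'. Qed.

Lemma upclosed_meet U W : upclosed U -> upclosed (fun A => U A || (W :&: A != set0)).
Proof.
move=> up A B AB /orP [/(up _ _ AB) -> //|/set0Pn [i]].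
rewrite inE => /andP [iW /(subsetP AB) iB].
by apply/orP; right; apply/set0Pn; exists i; rewrite inE iW.
Qed.

(** Variables that do not occur in the ideal are nonzerodivisors: each colon
    ideal is the ideal itself, and each step of the Koszul complex adds one to
    the length and nothing to the regularity. *)
Lemma resolved_vars U W p q t : upclosed U -> (forall A, U (A :|: W) = U A) ->
  resolved U p q t ->
  resolved (fun A => U A || (W :&: A != set0)) (p + #|W|) q t.
Proof.
move=> up UW res; have [n nW] := ubnP #|W|; elim: n W nW UW => // n IH W nW UW.
have [->|/set0Pn [v vW]] := eqVneq W set0.
  rewrite cards0 addn0; apply: eq_resolved res => A.
  by rewrite set0I eqxx orbF.
have WE : W = v |: W :\ v by rewrite setD1K.
have cardW : #|W| = #|W :\ v|.+1 by rewrite (cardsD1 v) vW.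
have UW' A : U (A :|: W :\ v) = U A.
  apply/idP/idP => [UA|]; last by apply: up; apply: subsetUl.
  by rewrite -UW; apply: up UA; rewrite setUS // subD1set.
have Uv A : U (A :|: [set v]) = U A.
  apply/idP/idP => [UA|]; last by apply: up; apply: subsetUl.
  by rewrite -UW; apply: up UA; rewrite setUS // sub1set.
have resW := IH _ (leq_trans (eq_leq (esym cardW)) nW) UW'.
have colon : resolved (fun A => U (A :|: [set v]) ||
    ((W :\ v) :&: (A :|: [set v]) != set0)) (p + #|W :\ v|) q t.
  apply: eq_resolved resW => A; rewrite Uv setIUr.
  suff -> : (W :\ v) :&: [set v] = set0 by rewrite setU0.
  by apply/setP => i; rewrite !inE; case: eqP; rewrite ?andbF.
have := resolved_add (upclosed_meet (W := W :\ v) up)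
  (resolvedW (leq_addr 1 _) (leqnn q) resW) colon.
rewrite cards1 addn1 cardW !addnS addn0 !eqxx => /(_ (leqnn _) (leqnn _)) res1.
apply: (resolved_flag _ (eq_resolved _ res1)) => [->|A]; first by rewrite orbT.
rewrite [in RHS]WE setIUl -orbA; congr (_ || _).
rewrite setU_eq0 negb_and orbC sub1set; congr (_ || _).
by rewrite setI_eq0 disjoints1 negbK.
Qed.

(** Quadrics are added one at a time in the order of [key].  Only the lengths of
    the resolutions of the successive colon ideals vary, and the extreme corner
    is reached as soon as it is reached by one of them. *)
Lemma resolved_edges (T : finType) (E : pred T) (f : T -> {set 'I_r})
    (key : T -> nat) U p q (pc : T -> nat) (tc : pred T) :
  injective key -> (forall e, #|f e| = 2) -> upclosed U ->
  resolved U p q.+1 false ->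
  (forall e, E e -> (pc e < p)%N /\
     resolved (fun A => U (A :|: f e) ||
       [exists e', [&& E e', (key e' < key e)%N & f e' \subset A :|: f e]])
       (pc e) q (tc e)) ->
  resolved (fun A => U A || [exists e, E e && (f e \subset A)]) p q.+1
    [exists e, [&& E e, tc e & (pc e).+1 == p]].
Proof.
move=> key_inj f2 up res colon.
pose V k A := U A || [exists e, [&& E e, (key e < k)%N & f e \subset A]].
have upV k : upclosed (V k).
  move=> A B AB /orP [/(up _ _ AB)|/existsP [e /and3P [Ee ke /subset_trans /(_ AB) fB]]].
    by rewrite /V => ->.
  by apply/orP; right; apply/existsP; exists e; rewrite Ee ke.
have resV k : resolved (V k) p q.+1
    [exists e, [&& E e, (key e < k)%N, tc e & (pc e).+1 == p]].
  elim: k => [|k IH].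
    apply: (resolved_flag _ (eq_resolved _ res)) => [/existsP [e /and3P []] // | A].
    rewrite /V; case: existsP => [[e /and3P []] //|_]; by rewrite orbF.
  have [/existsP [e /andP [Ee /eqP ke]]|/existsPn no] :=
      boolP [exists e, E e && (key e == k)]; last first.
    have eqk e : E e -> (key e < k.+1)%N = (key e < k)%N.
      by move=> Ee; have := no e; rewrite Ee /= ltnS leq_eqVlt => /negPf ->.
    apply: (resolved_flag _ (eq_resolved _ IH)) => [/existsP [e /and4P [Ee ke te pe]]|A].
      by apply/existsP; exists e; rewrite Ee -eqk // ke te pe.
    congr (_ || _); apply: eq_existsb => e; case Ee: (E e) => //=.
    by rewrite eqk.
  have [pce rese] := colon e Ee; rewrite ke in rese.
  have := resolved_add (upV k) IH rese pce; rewrite f2 addn2 => /(_ (leqnn _)) resk.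
  apply: (resolved_flag _ (eq_resolved _ resk)).
    move=> /existsP [e' /and4P [Ee' ke' te' pe']].
    have [lt|ge] := ltnP (key e') k.
      by apply/orP; left; apply/existsP; exists e'; rewrite Ee' lt te' pe'.
    have <- : e' = e by apply: key_inj; lia.
    by rewrite te' pe' eqxx orbT.
  move=> A; rewrite /V -orbA; congr (_ || _).
  apply/orP/existsP => [[/existsP [e' /and3P [Ee' ke' fA]]|fA]|[e' /and3P [Ee' ke' fA]]].
  - by exists e'; rewrite Ee' fA andbT; lia.
  - by exists e; rewrite Ee fA ke ltnSn.
  - have [lt|ge] := ltnP (key e') k.
      by left; apply/existsP; exists e'; rewrite Ee' lt.
    by right; have <- : e' = e by apply: key_inj; lia.
have bnd e : (key e < (\max_e key e).+1)%N by rewrite ltnS leq_bigmax.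
apply: (resolved_flag _ (eq_resolved _ (resV (\max_e key e).+1))).
  by move=> /existsP [e /and3P [Ee te pe]]; apply/existsP; exists e; rewrite Ee bnd te pe.
by move=> A; congr (_ || _); apply: eq_existsb => e; rewrite bnd.
Qed.

End Squarefree.

(** * The notched staircase *)

Section Staircase.

Variables (K : fieldType) (r N : nat) (x y : 'I_N -> 'I_r).
Hypotheses (x_inj : injective x) (y_inj : injective y).
Hypothesis xy_neq : forall a b, x a != y b.
Implicit Types (A : {set 'I_r}) (a b i j : 'I_N).

Definition edge (e : 'I_N * 'I_N) : {set 'I_r} := [set x e.1; y e.2].
Definition lex_key (e : 'I_N * 'I_N) : nat := e.1 * N + e.2.

Lemma edge_sub e A : (edge e \subset A) = (x e.1 \in A) && (y e.2 \in A).
Proof. by rewrite subUset !sub1set. Qed.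

Lemma card_edge e : #|edge e| = 2.
Proof. by rewrite cards2 xy_neq. Qed.

Lemma lex_keyP a b i j :
  (lex_key (a, b) < lex_key (i, j))%N = (a < i)%N || (a == i) && (b < j)%N.
Proof.
rewrite /lex_key /=; have := ltn_ord b; have := ltn_ord j.
rewrite -val_eqE /=; case: (ltngtP a i) => ai; try nia.
Qed.

Lemma lex_key_inj : injective lex_key.
Proof.
move=> [a b] [i j] E; have := lex_keyP a b i j; have := lex_keyP i j a b.
rewrite E ltnn; case: (ltngtP a i) => // /val_inj ->.
by rewrite eqxx /=; case: ltngtP => // /val_inj ->.
Qed.

Lemma x_in_edge A a e : (x a \in A :|: edge e) = (x a \in A) || (a == e.1).
Proof. by rewrite !inE (negPf (xy_neq _ _)) orbF (inj_eq x_inj). Qed.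

Lemma y_in_edge A b e : (y b \in A :|: edge e) = (y b \in A) || (b == e.2).
Proof. by rewrite !inE (eq_sym (y b)) (negPf (xy_neq _ _)) (inj_eq y_inj). Qed.

Definition interval_vars (i0 i1 j0 j1 : nat) : {set 'I_r} :=
  x @: [set i : 'I_N | i0 <= i < i1] :|: y @: [set j : 'I_N | j0 <= j < j1].

Lemma card_interval (i0 i1 : nat) : i1 <= N -> #|[set i : 'I_N | i0 <= i < i1]| = i1 - i0.
Proof.
move=> i1N; elim: i1 i1N => [|i1 IH] i1N.
  by rewrite sub0n; apply: eq_card0 => i; rewrite !inE ltn0 andbF.
have [lt|le] := ltnP i1 i0.
  rewrite (_ : _ - _ = 0); last by lia.
  by apply: eq_card0 => i; rewrite !inE; lia.
rewrite subSn // -IH; last by lia.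
rewrite (cardsD1 (Ordinal i1N)) !inE /= le ltnSn add1n; congr _.+1.
by apply: eq_card => i; rewrite !inE -val_eqE /=; lia.
Qed.

Lemma card_interval_vars (i0 i1 j0 j1 : nat) : i1 <= N -> j1 <= N ->
  #|interval_vars i0 i1 j0 j1| = (i1 - i0) + (j1 - j0).
Proof.
move=> i1N j1N; rewrite cardsU !card_imset // !card_interval //.
rewrite (_ : _ :&: _ = set0) ?cards0 ?subn0 //; apply/setP => v; rewrite !inE.
apply/andP => -[/imsetP [i _ ->] /imsetP [j _ E]].
by have := xy_neq i j; rewrite E eqxx.
Qed.

Lemma interval_varsP (i0 i1 j0 j1 : nat) A :
  reflect ((exists2 i : 'I_N, i0 <= i < i1 & x i \in A) \/
           (exists2 j : 'I_N, j0 <= j < j1 & y j \in A))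
    (interval_vars i0 i1 j0 j1 :&: A != set0).
Proof.
apply: (iffP (set0Pn _)) => [[v]|].
  rewrite !inE => /andP [/orP [] /imsetP [i + ->] vA]; rewrite inE => iI.
    by left; exists i.
  by right; exists i.
move=> [] [i iI iA]; [exists (x i)|exists (y i)]; rewrite !inE iA andbT.
  by apply/orP; left; apply: imset_f; rewrite inE.
by apply/orP; right; apply: imset_f; rewrite inE.
Qed.

Lemma resolved_interval_vars U p q t (i0 i1 j0 j1 : nat) : i1 <= N -> j1 <= N ->
  upclosed U -> (forall A, U (A :|: interval_vars i0 i1 j0 j1) = U A) ->
  resolved K U p q t ->
  resolved K (fun A => U A || (interval_vars i0 i1 j0 j1 :&: A != set0))
    (p + (i1 - i0 + (j1 - j0))) q t.
Proof.
move=> i1N j1N up UW res; rewrite -(card_interval_vars i0 j0 i1N j1N).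
exact: resolved_vars.
Qed.

Definition ferrers (s k : nat) : pred {set 'I_r} := fun A =>
  [exists e : 'I_N * 'I_N, [&& e.1 < s, e.1 <= e.2, e.2 < k & edge e \subset A]].

Lemma ferrersP s k A :
  reflect (exists a b : 'I_N, [/\ a < s, a <= b, b < k, x a \in A & y b \in A])
    (ferrers s k A).
Proof.
apply: (iffP existsP) => [[[a b] /and4P [/= ? ? ?]]|[a [b [? ? ? xA yA]]]].
  by rewrite edge_sub => /andP [? ?]; exists a, b.
by exists (a, b); rewrite edge_sub /= xA yA; apply/and4P.
Qed.

Lemma upclosed_ferrers s k : upclosed (ferrers s k).
Proof.
move=> A B /subsetP AB /ferrersP [a [b [? ? ? /AB ? /AB ?]]].
by apply/ferrersP; exists a, b.
Qed.

(** For the pair (x_a, y_b) the earlier pairs (x_i, y_b) with i < a and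
    (x_a, y_j) with a <= j < b put x_0..x_(a-1) and y_a..y_(b-1) into the colon
    ideal, and every other earlier pair involves some x_i with i < a.  These are
    b variables in all. *)
Lemma resolved_ferrers s k : s <= N -> k <= N ->
  resolved K (ferrers s k) k 1 ((0 < s) && (0 < k)).
Proof.
move=> sN kN.
pose E (e : 'I_N * 'I_N) := [&& e.1 < s, e.1 <= e.2 & e.2 < k].
have up0 : upclosed (xpred0 : pred {set 'I_r}) by [].
have res0 : resolved K (xpred0 : pred {set 'I_r}) k 1 false.
  by apply: resolved_flag (resolvedW (leq0n k) (leq0n 1) (@resolved0 K r)).
have res : resolved K (fun A => false || [exists e, E e && (edge e \subset A)]) k 1
    [exists e : 'I_N * 'I_N, [&& E e, true & e.2.+1 == k]].
  apply: (@resolved_edges K r _ E edge lex_key xpred0 k 0 (fun e => e.2 : nat) xpredT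
    lex_key_inj card_edge up0 res0).
  move=> [a b] /and3P [/= as_ ab bk]; split=> //.
  have := resolved_interval_vars (ltnW (ltn_ord a)) (ltnW (ltn_ord b)) up0
    (fun=> erefl) (@resolved0 K r) (i0 := 0) (j0 := a).
  rewrite subn0 add0n subnKC //; apply: eq_resolved => A /=.
  apply/interval_varsP/existsP => [[[i lt iA]|[j lt jA]]|].
  + exists (i, b); rewrite lex_keyP edge_sub x_in_edge y_in_edge iA eqxx orbT.
    by rewrite (_ : i < a) // /E /=; lia.
  + exists (a, j); rewrite lex_keyP edge_sub x_in_edge y_in_edge jA !eqxx orbT.
    by rewrite (_ : j < b) ?orbT // /E /=; lia.
  move=> [[i j] /and3P [/and3P /= [is_ ij jk]]]; rewrite lex_keyP edge_sub.
  rewrite x_in_edge y_in_edge /=.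
  case: eqVneq is_ ij => [->|_] is_ ij /=; rewrite ?ltnn ?orbF => lt.
    rewrite orbT /=; case: eqVneq lt => [->|_]; rewrite ?ltnn // orbF => lt jA.
    by right; exists j => //; lia.
  by move=> /andP [iA _]; left; exists i.
apply: (resolved_flag _ (eq_resolved _ res)).
  move=> /andP [s0 k0]; apply/existsP.
  have lt0 : 0 < N by lia. have ltk : k.-1 < N by lia.
  (* The colon ideal of (x_0, y_(k-1)) has k - 1 variables. *)
  by exists (Ordinal lt0, Ordinal ltk); rewrite /E /=; lia.
by move=> A; apply: eq_existsb => e; rewrite /E -!andbA.
Qed.

Definition notched (s k : nat) : pred {set 'I_r} := fun A =>
  [exists e : 'I_N * 'I_N, [&& e.1 <= e.2, (s <= e.1) || (e.2 < k) & edge e \subset A]].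

(** The pairs with b < k come first, being a Ferrers staircase by themselves.
    For a later pair (x_a, y_b), a >= s and b >= k, the earlier pairs (x_i, y_b)
    exist only for i >= s because of the notch.  So x_0..x_(s-1) stay out of the
    linear part of the colon ideal, and their pairs with the y_j, j < min(a, k),
    survive as a staircase of regularity 1; this is what raises the regularity
    to 2. *)
Lemma resolved_notched s k : 0 < s -> s < k -> k < N ->
  resolved K (notched s k) (k + (N - s)) 2 true.
Proof.
move=> s0 sk kN.
have sN : s <= N by lia.
pose E (e : 'I_N * 'I_N) := [&& s <= e.1, e.1 <= e.2 & k <= e.2].
pose pc (e : 'I_N * 'I_N) := (minn e.1 k + ((e.1 - s) + (e.2 - e.1)))%N.
have res0 : resolved K (ferrers N k) (k + (N - s)) 2 false.
  apply: resolved_flag (resolvedW _ _ (resolved_ferrers (leqnn N) (ltnW kN))) => //.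
  exact: leq_addr.
have res : resolved K (fun A => ferrers N k A || [exists e, E e && (edge e \subset A)])
    (k + (N - s)) 2 [exists e, [&& E e, k <= e.1 & (pc e).+1 == (k + (N - s))%N]].
  apply: (@resolved_edges K r _ E edge lex_key (ferrers N k) (k + (N - s)) 1 pc
    (fun e => k <= e.1) lex_key_inj card_edge (@upclosed_ferrers N k) res0).
  move=> [a b] /and3P [/= sa ab kb]; split; first by have := ltn_ord b; rewrite /pc /=; lia.
  set W := interval_vars s a a b.
  have mN : minn a k <= N by lia.
  have UW A : ferrers s (minn a k) (A :|: W) = ferrers s (minn a k) A.
    apply/idP/idP; last by apply: upclosed_ferrers; apply: subsetUl.
    move=> /ferrersP [i [j [is_ ij jk]]]; rewrite (in_setU (x i)) (in_setU (y j)).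
    have /negPf -> : x i \notin W.
      apply/negP; rewrite in_setU => /orP [] /imsetP [v]; rewrite inE => vI.
        by move/x_inj=> iv; move: vI; rewrite -iv; lia.
      by move/eqP; rewrite (negPf (xy_neq _ _)).
    have /negPf -> : y j \notin W.
      apply/negP; rewrite in_setU => /orP [] /imsetP [v]; rewrite inE => vI.
        by move/eqP; rewrite eq_sym (negPf (xy_neq _ _)).
      by move/y_inj=> jv; move: vI; rewrite -jv; lia.
    by rewrite !orbF => xA yA; apply/ferrersP; exists i, j.
  have := resolved_interval_vars (ltnW (ltn_ord a)) (ltnW (ltn_ord b))
    (@upclosed_ferrers s _) UW (resolved_ferrers sN mN).
  move=> resW; apply: (resolved_flag _ (eq_resolved _ resW)) => [ka|A]; first by lia.
  apply/orP/orP => [[]|[]].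
  - move=> /ferrersP [i [j [is_ ij]]]; rewrite leq_min => /andP [ja jk] xA yA.
    left; apply/ferrersP; exists i, j; split=> //.
      by rewrite x_in_edge xA.
    by rewrite y_in_edge yA.
  - case/interval_varsP => [[i si iA]|[j aj jA]].
      right; apply/existsP; exists (i, b).
      rewrite lex_keyP edge_sub x_in_edge y_in_edge iA eqxx orbT.
      by rewrite (_ : i < a) // /E /=; lia.
    have [jk|kj] := ltnP j k.
      left; apply/ferrersP; exists a, j; split=> //; first by lia.
        by rewrite x_in_edge eqxx orbT.
      by rewrite y_in_edge jA.
    right; apply/existsP; exists (a, j).
    rewrite lex_keyP edge_sub x_in_edge y_in_edge jA !eqxx orbT.
    by rewrite (_ : j < b) ?orbT // /E /=; lia.
  - move=> /ferrersP [i [j [_ ij jk]]]; rewrite x_in_edge y_in_edge /=.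
    have -> : (j == b) = false by apply/eqP => jb; move: jk; rewrite jb; lia.
    rewrite orbF => xA yA.
    have [aj|ja] := leqP a j.
      by right; apply/interval_varsP; right; exists j => //; lia.
    case: eqVneq xA ij => [->|_]; first by lia.
    rewrite orbF => xA ij; have [si|is_] := leqP s i.
      by right; apply/interval_varsP; left; exists i => //; lia.
    by left; apply/ferrersP; exists i, j; split=> //; lia.
  - move=> /existsP [[i j] /and3P [/and3P /= [si ij kj]]].
    rewrite lex_keyP edge_sub x_in_edge y_in_edge /= => lt xyA.
    right; apply/interval_varsP.
    case: eqVneq lt xyA ij => [->|_] /=; rewrite ?ltnn ?orbF => lt.
      rewrite orbT /=; case: eqVneq lt => [->|_]; rewrite ?ltnn // orbF => lt jA ij.
      by right; exists j => //; lia.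
    by move=> /andP [iA _] ij; left; exists i => //; lia.
apply: (resolved_flag _ (eq_resolved _ res)) => [_|A].
  have lastP : N.-1 < N by lia.
  (* At (x_(N-1), y_(N-1)) the colon ideal has N - 1 - s variables and the
     staircase with full length k. *)
  by apply/existsP; exists (Ordinal lastP, Ordinal lastP); rewrite /E /pc /=; lia.
apply/orP/existsP => [[/existsP [e /and4P [_ ij jk eA]]|/existsP [e /andP [/and3P [si ij kj] eA]]]|].
- by exists e; rewrite ij jk orbT.
- by exists e; rewrite ij si.
move=> [e /and3P [ij + eA]]; have [jk _|kj] := ltnP e.2 k.
  by left; apply/existsP; exists e; rewrite ltn_ord ij jk.
by rewrite orbF => si; right; apply/existsP; exists e; rewrite /E si ij kj.
Qed.

End Staircase.

(** * Monotone walks in closed graphs *)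

Section MonotoneWalks.

Variables (T : finType) (e lt : rel T).
Hypotheses (e_irr : irreflexive e) (lt_total : forall u v, u != v -> lt u v || lt v u).

Definition monotone_edge (l : rel T) : rel T := [rel u v | e u v && l u v].

Definition fork_closed (l : rel T) :=
  forall u v w, v != w -> e u v -> e u w -> l u v -> l u w -> e v w.

(** A step down to v followed by a step up to v1 can be short-cut by the edge
    between u and v1, which is an edge since both are neighbours of v on the
    same side. *)
Lemma climb_after_drop (l : rel T) u v w : (forall u v, u != v -> l u v || l v u) ->
  ssrbool.symmetric e -> fork_closed l ->
  connect (monotone_edge l) v w -> e u v -> l v u ->
  connect (monotone_edge l) u w || connect (monotone_edge (fun a b => l b a)) u w.
Proof.
move=> l_total e_sym fork /connectP [p + ->]; elim: p v => [|v1 p IH] v /=.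
  by move=> _ uv vu; apply/orP; right; apply: connect1; rewrite /monotone_edge /= uv.
move=> /andP [/andP [/= vv1 lvv1] pth] uv vu.
have con : connect (monotone_edge l) v1 (last v1 p) by apply/connectP; exists p.
have [->|neq] := eqVneq u v1; first by rewrite con.
have uv1 : e u v1 by apply: fork neq _ vv1 vu lvv1; rewrite e_sym.
have /orP [lt1|lt1] := l_total _ _ neq; last exact: IH.
by apply/orP; left; apply: connect_trans con; apply: connect1; rewrite /monotone_edge /= uv1.
Qed.

Lemma connect_monotone u w : ssrbool.symmetric e ->
  fork_closed lt -> fork_closed (fun a b => lt b a) -> connect e u w ->
  connect (monotone_edge lt) u w || connect (monotone_edge (fun a b => lt b a)) u w.
Proof.
move=> e_sym fork fork' /connectP [p + ->]; elim: p u => [|v p IH] u /=.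
  by move=> _; rewrite connect0.
move=> /andP [uv /IH con].
have neq : u != v by apply: contraTneq uv => ->; rewrite e_irr.
have lt_total' a b : a != b -> lt b a || lt a b by rewrite orbC; apply: lt_total.
have /orP [luv|lvu] := lt_total neq; case/orP: con => con.
- by apply/orP; left; apply: connect_trans con; apply: connect1; rewrite /monotone_edge /= uv.
- by rewrite orbC; apply: (climb_after_drop (l := fun a b => lt b a)) con uv luv.
- exact: climb_after_drop con uv lvu.
- by apply/orP; right; apply: connect_trans con; apply: connect1; rewrite /monotone_edge /= uv.
Qed.

End MonotoneWalks.

(** * The shape of the initial-closed graph *)

Section ClosedGraph.

Variables (n : nat) (G : rel 'I_n).
Hypotheses (hG : simple_graph G) (hconn : connected_graph G) (hclosed : closed_graph G).

(** A monotone walk from i to i + 1 has no room for intermediate vertices. *)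
Lemma closed_graph_succ (i j : 'I_n) : j = i.+1 :> nat -> G i j.
Proof.
move=> ij; have [G_sym G_irr] := hG.
have tot (u v : 'I_n) : u != v -> (u < v) || (v < u) by rewrite -val_eqE neq_ltn.
have fork_lt : fork_closed G (fun u v => u < v).
  by move=> u v w vw uv uw lt1 lt2; apply: (hclosed vw uv uw); rewrite lt1 lt2.
have fork_gt : fork_closed G (fun u v => v < u).
  by move=> u v w vw uv uw lt1 lt2; apply: (hclosed vw uv uw); rewrite lt1 lt2 orbT.
have le (l : rel 'I_n) (R : rel nat) : (forall u v, l u v -> R u v) ->
    reflexive R -> transitive R -> forall u v, connect (monotone_edge G l) u v -> R u v.
  move=> lR Rr Rt u v /connectP [p + ->]; elim: p u => [|u1 p IH] u /=; first by rewrite Rr.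
  by move=> /andP [/andP [_ /lR uu1] /IH]; apply: Rt.
have /orP [|down] := connect_monotone G_irr tot G_sym fork_lt fork_gt (hconn i j); last first.
  have := le _ geq (fun _ _ => @ltnW _ _) leqnn (fun _ _ _ a b => leq_trans b a) _ _ down.
  by rewrite /= ij ltnn.
move=> /connectP [[|v p] /= + jE]; first by move: ij; rewrite jE => /n_Sn.
move=> /andP [/andP [iv /= lt_iv] vp].
have := le _ leq (fun _ _ => @ltnW _ _) leqnn leq_trans v j.
have -> : connect (monotone_edge G (fun u v => u < v)) v j by apply/connectP; exists p.
move=> /(_ isT) vj; suff <- : v = j by [].
by apply: val_inj => /=; lia.
Qed.

Lemma closed_graph_right (d : nat) (i i' j : 'I_n) :
  i' = i + d :> nat -> i' < j -> G i j -> G i' j.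
Proof.
elim: d i => [|d IH] i ii' i'j Gij.
  by rewrite (_ : i' = i) //; apply: val_inj; rewrite /= ii' addn0.
have i1n : i.+1 < n by have := ltn_ord j; lia.
apply: (IH (Ordinal i1n)) => //=; first by lia.
apply: (hclosed (i := i)) => //; first by rewrite -val_eqE /=; lia.
  exact: closed_graph_succ.
by apply/orP; left; rewrite ltnSn /=; lia.
Qed.

Lemma closed_graph_left (d : nat) (i j j' : 'I_n) :
  j = j' + d :> nat -> i < j' -> G i j -> G i j'.
Proof.
have [G_sym _] := hG; elim: d j => [|d IH] j jj' ij' Gij.
  by rewrite (_ : j' = j) //; apply: val_inj; rewrite /= jj' addn0.
have j1n : j.-1 < n by have := ltn_ord j; lia.
apply: (IH (Ordinal j1n)) => //=; first by lia.
rewrite G_sym; apply: (hclosed (i := j)); rewrite ?(G_sym j) //.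
- by rewrite -val_eqE /=; lia.
- by apply: closed_graph_succ => /=; lia.
- by apply/orP; right; rewrite /=; lia.
Qed.

Lemma closed_graph_interval (i i' j' j : 'I_n) :
  i <= i' -> i' < j' -> j' <= j -> G i j -> G i' j'.
Proof.
move=> ii' i'j' j'j /(closed_graph_left (d := j - j') (j' := j')) Gij'.
by apply: (@closed_graph_right (i' - i) i) => //; [lia | apply: Gij'; lia].
Qed.

(** Otherwise i + 1 would be a cut point: an edge jumping over it would, by
    [closed_graph_interval], force the edge {i, i + 2}, so that no walk
    avoiding i + 1 leaves the vertices up to i. *)
Lemma closed_graph_skip (i j : 'I_n) :
  (forall v, ~ cut_point G v) -> j = i.+2 :> nat -> G i j.
Proof.
move=> hcut ij; have i1n : i.+1 < n by have := ltn_ord j; lia.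
pose v := Ordinal i1n.
have [//|NG] := boolP (G i j); case: (hcut v); exists i, j; split.
- by rewrite -val_eqE /=; lia.
- by rewrite -val_eqE /=; lia.
(* No edge jumps over [v] from the vertices up to [i]. *)
have low (a b : 'I_n) : a <= i -> b != v -> G a b -> b <= i.
  rewrite -val_eqE /= => ai bv Gab; rewrite leqNgt; apply/negP => ib.
  by case/negP: NG; apply: closed_graph_interval Gab; lia.
have stay p (u : 'I_n) : u <= i ->
    path [rel a b | [&& a != v, b != v & G a b]] u p -> last u p <= i.
  elim: p u => [|u1 p IH] u //= ui /andP [/and3P [_ u1v Guu1]].
  exact/IH/(low u).
apply/negP => /connectP [p /(stay _ _ (leqnn i)) + jE].
by rewrite -jE ij; lia.
Qed.

Lemma initial_closedE (a b : 'I_n.-1) (ha : a < n) (hb : b.+1 < n) :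
  initial_closed G (inl a) (inr b) = (a <= b) && G (Ordinal ha) (Ordinal hb).
Proof.
apply/existsP/andP => [[i /existsP [j /and4P [/eqP ia /eqP jb ij Gij]]]|[ab Gab]].
  split; first by lia.
  have -> : Ordinal ha = i by apply: val_inj; rewrite /= ia.
  by have -> : Ordinal hb = j by apply: val_inj; rewrite /= jb.
by exists (Ordinal ha); apply/existsP; exists (Ordinal hb); rewrite /= !eqxx ltnS ab.
Qed.

Lemma down_set_interval (N : nat) (a : 'I_N) (D : pred 'I_N) (b : 'I_N) :
  (forall c, D c -> a <= c) -> (forall c d : 'I_N, D c -> a <= d <= c -> D d) ->
  D b = (a <= b < a + #|D|).
Proof.
move=> Da Dd; have [Db|NDb] := boolP (D b).
  have ab := Da _ Db; rewrite ab /=; apply/esym.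
  have : #|[set c : 'I_N | a <= c < b.+1]| <= #|D|.
    by apply/subset_leq_card/subsetP => c; rewrite inE => cI; apply: Dd Db _.
  by rewrite card_interval ?ltn_ord //; lia.
apply/esym/negbTE; rewrite negb_and -implybE; apply/implyP => ab; rewrite -leqNgt.
have : #|D| <= #|[set c : 'I_N | a <= c < b]|.
  apply/subset_leq_card/subsetP => c Dc; rewrite inE (Da _ Dc) /= ltnNge.
  by apply: contra NDb => bc; apply: (Dd c) => //; rewrite ab.
by rewrite card_interval ?(ltnW (ltn_ord b)) //; lia.
Qed.

Lemma nth_mu (a : 'I_n.-1) :
  nth 0 (mu G) a = n - a.+1 - degree (initial_closed G) (inl a).
Proof. by rewrite (nth_map a) ?size_enum_ord // nth_ord_enum. Qed.

(** The neighbours of x_a form an interval starting at y_a, whose length is the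
    degree and hence is recorded by mu. *)
Lemma initial_closed_mu (a b : 'I_n.-1) :
  initial_closed G (inl a) (inr b) = (a <= b < n.-1 - nth 0 (mu G) a).
Proof.
pose D : pred 'I_n.-1 := fun c => initial_closed G (inl a) (inr c).
have ltn_n (c : 'I_n.-1) : c < n by have := ltn_ord c; lia.
have ltSn (c : 'I_n.-1) : c.+1 < n by have := ltn_ord c; lia.
have DE c : D c = (a <= c) && G (Ordinal (ltn_n a)) (Ordinal (ltSn c)).
  exact: initial_closedE.
have Da (c : 'I_n.-1) : D c -> a <= c by rewrite DE => /andP [].
have Dd (c d : 'I_n.-1) : D c -> a <= d <= c -> D d.
  rewrite !DE => /andP [ac Gac] /andP [ad dc]; rewrite ad.
  exact: (closed_graph_interval _ _ _ Gac).
have degE : degree (initial_closed G) (inl a) = #|D|.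
  rewrite /degree -(card_imset D (@inr_inj 'I_n.-1 'I_n.-1)).
  apply: eq_card => -[c|c]; rewrite inE.
    by apply/esym/negbTE/imsetP => -[].
  by rewrite mem_imset //; exact: inr_inj.
have Dle : a + #|D| <= n.-1.
  have : #|D| <= #|[set c : 'I_n.-1 | a <= c < n.-1]|.
    by apply/subset_leq_card/subsetP => c Dc; rewrite inE (Da _ Dc) ltn_ord.
  by rewrite card_interval //; have := ltn_ord a; lia.
rewrite -/(D b) (down_set_interval b Da Dd) nth_mu degE.
by congr (_ && (_ < _)); have := ltn_ord a; lia.
Qed.

End ClosedGraph.

(** * Edge ideals *)

Section EdgeIdeal.

Variables (K : fieldType) (V : finType) (e : rel V).
Hypothesis e_irr : irreflexive e.
Local Open Scope ring_scope.

Definition edge_family : pred {set 'I_#|V|} := fun A =>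
  [exists u, exists v, [&& e u v, enum_rank u \in A & enum_rank v \in A]].

Lemma upclosed_edge_family : upclosed edge_family.
Proof.
move=> A B /subsetP AB /existsP [u /existsP [v /and3P [euv /AB uB /AB vB]]].
by apply/existsP; exists u; apply/existsP; exists v; apply/and3P.
Qed.

Lemma edge_idealD p q : edge_ideal e p -> edge_ideal e q -> @edge_ideal K V e (p + q).
Proof.
move=> [c ->] [d ->]; exists (fun u v => c u v + d u v).
rewrite -big_split; apply: eq_bigr => u _; rewrite -big_split.
by apply: eq_bigr => v _; rewrite mulrDl.
Qed.

Lemma edge_ideal_mul u v p : e u v ->
  @edge_ideal K V e (p * ('X_(enum_rank u) * 'X_(enum_rank v))).
Proof.
move=> euv; exists (fun u' v' => if (u' == u) && (v' == v) then p else 0).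
rewrite (bigD1 u) //= (bigD1 v) //= !eqxx /= !big1 ?addr0 // => [u' /negPf ->|v'].
  by rewrite big1 // => v' _; rewrite mul0r.
by case/andP => _ /negPf ->; rewrite mul0r.
Qed.

Lemma edge_ideal_sqfree p : sqfree_ideal edge_family p <-> @edge_ideal K V e p.
Proof.
split=> [Ip|[c ->] m].
  rewrite [p]mpolyE big_seq; elim/big_ind: _ => [|q q'|m].
  - exists (fun _ _ => 0); apply/esym; rewrite big1 // => u _; rewrite big1 // => v _.
    by rewrite mul0r.
  - exact: edge_idealD.
  move=> /Ip /existsP [u /existsP [v /and3P [euv um vm]]].
  have uv : enum_rank u != enum_rank v.
    by rewrite (inj_eq enum_rank_inj); apply: contraTneq euv => ->; rewrite e_irr.
  have -> : 'X_[m] = 'X_[K, (m - (U_(enum_rank u) + U_(enum_rank v)))]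
                       * ('X_(enum_rank u) * 'X_(enum_rank v)).
    rewrite -!mpolyXD submK //; apply/mnm_lepP => i; rewrite mnmDE !mnm1E.
    move: um vm; rewrite !inE; have [<-|_] := eqVneq (enum_rank u) i.
      by rewrite (eq_sym (enum_rank v)) (negPf uv) addn0 lt0n.
    by have [<-|//] := eqVneq (enum_rank v) i; rewrite add0n lt0n.
  by rewrite scalerAl; apply: edge_ideal_mul.
move=> /msupp_sum_le /flattenP [s /mapP [u _ ->]].
move=> /msupp_sum_le /flattenP [s' /mapP [v + ->]]; rewrite mem_filter => /andP [euv _].
rewrite -mpolyXD (perm_mem (msuppMX _ _)) => /mapP [m' _ ->].
apply/existsP; exists u; apply/existsP; exists v; rewrite euv !inE !mnmDE !mnm1E !eqxx.
by rewrite -!lt0n; lia.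
Qed.

End EdgeIdeal.

(** * Extremal Betti numbers *)

Section ExtremalBetti.

Variables (K : fieldType) (r : nat) (I : {mpoly K[r]} -> Prop).
Variable F : min_graded_resolution I.
Local Open Scope ring_scope.

Definition gres_of_min : gres I.
Proof.
apply: (@Gres K r I (fun l => size (gens F l)) (fun l i => nth 0%N (gens F l) i)
  (aug F) (@diff _ _ _ F)).
- by move=> i j m; rewrite (ord1 j) !addn0 => /aug_homog.
- by move=> l i j m /diff_homog ->; rewrite addn0.
- exact: aug_surj.
- exact: aug_exact.
- exact: diff_exact.
Defined.

Lemma betti_neq0P l j :
  betti F l j <> 0%N <-> exists b : 'I_(rk gres_of_min l), dg gres_of_min b = j.
Proof.
rewrite /betti; split=> [/eqP|[b bj]].
  rewrite -lt0n -has_count has_pred1 => /(nthP 0%N) [i il ij].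
  by exists (Ordinal il).
by apply/eqP; rewrite -lt0n -has_count has_pred1 -bj; apply: mem_nth.
Qed.

(** The hypothesis confines the Betti numbers of F to l <= p, j - l <= q and
    provides a generator in the corner (p, p + q) of that region, so every other
    nonzero Betti number has this one in its forbidden quadrant. *)
Lemma unique_extremal_betti U p q :
  upclosed U -> (forall x, sqfree_ideal U x <-> I x) -> resolved K U p q true ->
  extremal (betti F) p (p + q) /\
  forall i j : nat, extremal (betti F) i j -> i = p /\ j = (p + q)%N.
Proof.
move=> up UI [P0 [Ppd Preg /(_ isT) [b bE]]].
pose P := gres_ext UI P0.
have gI : graded_ideal I.
  have [gD gM gR] := @sqfree_graded_ideal K _ _ up.
  split=> [x y /UI Ix /UI Iy|x y /UI Iy|d x /UI Ix]; apply/UI.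
  - exact: gD.
  - exact: gM.
  - exact: gR.
have bound l j : betti F l j <> 0%N -> (l <= p)%N /\ (j <= l + q)%N.
  move=> /betti_neq0P [c cj].
  have cmin : minimal_at c.
    by split=> [c'|]; [|case: l c {cj} => // l c c']; exact: diff_minimal.
  have [c' c'E] := minimal_generator P gI cmin.
  split; last by rewrite -cj -c'E; exact: Preg.
  rewrite leqNgt; apply/negP => /Ppd l0.
  by case: (cast_ord l0 c').
have bmin : @minimal_at _ _ _ P p b.
  split=> [c|]; first by case: (cast_ord (Ppd _ (ltnSn p)) c).
  case: p b bE {Ppd bound} => // p b bE c; apply/eqP; rewrite mcoeff_eq0.
  apply/negP => /dif_homog /=; rewrite mdeg0 bE addn0 add0n => cE.
  by have := Preg _ c; rewrite cE addSn ltnn.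
have [c cE] := minimal_generator gres_of_min gI bmin.
have nz : betti F p (p + q) <> 0%N by apply/betti_neq0P; exists c; rewrite cE.
split=> [|i j [bij ext]].
  split=> // l s pl ps le; apply/eqP/negPn/negP => /eqP /bound [lp sl]; lia.
have [ip jq] := bound _ _ bij.
have [lt|ge] := ltnP j (p + q); last by split; lia.
by case: nz; apply: ext => //; lia.
Qed.

End ExtremalBetti.

Theorem corollary3p8 (K : fieldType) (n : nat) (G : rel 'I_n)
    (hn : (2 <= n)%N)
    (hG : simple_graph G)
    (hconn : connected_graph G)
    (hclosed : closed_graph G)
    (hcut : forall v : 'I_n, ~ cut_point G v)
    (s : nat)
    (hs : (1 <= s <= n - 3)%N)
    (hmu0 : forall i : nat, (s <= i < n.-1)%N -> nth 0%N (mu G) i = 0%N)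
    (hmupos : (0 < nth 0%N (mu G) s.-1)%N)
    (hmueq : forall i : nat, (i < s)%N -> nth 0%N (mu G) i = nth 0%N (mu G) 0)
    (F : min_graded_resolution (@edge_ideal K _ (initial_closed G))) :
  let p := (2 * (n - 1) - (nth 0%N (mu G) 0 + s))%N in
  extremal (betti F) p (p + 2) /\
  forall i j : nat, extremal (betti F) i j -> i = p /\ j = (p + 2)%N.
Proof.
move=> p; set m := nth 0 (mu G) 0 in p hmueq *.
have [s1 sn] := andP hs.
have m0 : 0 < m by rewrite -(hmueq s.-1) //; lia.
have s1N : s.-1 < n.-1 by lia.
have sN : s < n.-1 by lia.
have edgeE := initial_closed_mu hG hconn hclosed.
have notch : s < n.-1 - m.
  have s1n : s.-1 < n by lia.
  have s2n : s.+1 < n by lia.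
  have := edgeE (Ordinal s1N) (Ordinal sN).
  rewrite (@initial_closedE n G (Ordinal s1N) (Ordinal sN) s1n s2n) (closed_graph_skip hG hconn hclosed) //=; last by lia.
  by rewrite hmueq; lia.
pose V : finType := ('I_n.-1 + 'I_n.-1)%type.
pose x (a : 'I_n.-1) : 'I_#|V| := enum_rank (inl a : V).
pose y (b : 'I_n.-1) : 'I_#|V| := enum_rank (inr b : V).
have x_inj : injective x by move=> a b /enum_rank_inj [].
have y_inj : injective y by move=> a b /enum_rank_inj [].
have xy_neq a b : x a != y b by rewrite (inj_eq enum_rank_inj).
have H_irr : irreflexive (initial_closed G) by case.
have res := resolved_notched K x_inj y_inj xy_neq s1 notch ltac:(lia).
have -> : p = (n.-1 - m + (n.-1 - s))%N by rewrite /p; lia.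
apply: (unique_extremal_betti F (@upclosed_edge_family _ (initial_closed G))
  (edge_ideal_sqfree H_irr)).
apply: eq_resolved res => A.
have nE (a b : 'I_n.-1) : initial_closed G (inl a) (inr b) =
    (a <= b) && ((s <= a) || (b < n.-1 - m)).
  rewrite edgeE; congr (_ && _); have [sa|as_] := leqP s a.
    by rewrite hmu0 ?subn0 ?ltn_ord ?sa ?ltn_ord.
  by rewrite hmueq.
have HC (a b : 'I_n.-1) : initial_closed G (inr b) (inl a) = initial_closed G (inl a) (inr b).
  by [].
apply/existsP/existsP => [[[a b] /and3P [ab sk]]|[u /existsP [v /and3P []]]].
  rewrite edge_sub => /andP [xA yA]; exists (inl a); apply/existsP; exists (inr b).
  by rewrite nE ab sk xA yA.
case: u => u; case: v => v //; rewrite ?HC nE => /andP [uv sk] uA vA;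
  [exists (u, v)|exists (v, u)]; by rewrite edge_sub uv sk /=; apply/andP.
Qed.
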